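(* For a positive integer $d$, let $\mathcal{T}_d$ be the class of trees all of whose non-leaf vertices have degree at least $d$. Then every tree in $\mathcal{T}_d$ is well-burnable when $d\ge4$, and every tree in $\mathcal{T}_3$ on at least $81$ vertices is well-burnable.
   Context: Burning process on a graph $G$: in round 1 one vertex is chosen and set on fire; in each subsequent round, first every burning vertex sets all its neighbours on fire, then one new vertex is chosen and set on fire; the process ends when all vertices are on fire. The burning number $b(G)$ is the minimum number of rounds needed. A graph on $n$ vertices is well-burnable if $b(G)\le\lceil\sqrt n\,\rceil$. *)

(* Defs.v *)
From HB Require Import structures.
From mathcomp Require Import all_boot all_order all_algebra all_field.

Set Implicit Arguments.
Unset Strict Implicit.
Unset Printing Implicit Defensive.

Import Num.Theory.

Definition simple_graph (T : finType) (e : rel T) : Prop :=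
  symmetric e /\ irreflexive e.

Definition degree (T : finType) (e : rel T) (x : T) : nat := #|[set y | e x y]|.

Definition leaf (T : finType) (e : rel T) (x : T) : bool := degree e x == 1.

Definition connected_graph (T : finType) (e : rel T) : Prop :=
  0 < #|T| /\ forall x y : T, connect e x y.

(* [ucycle e c] accepts [[:: x; y]] for any edge, so that graph cycles are the
   [ucycle]s with at least three vertices. *)
Definition acyclic_graph (T : finType) (e : rel T) : Prop :=
  forall c : seq T, ucycle e c -> ~ (3 <= size c).

Definition tree (T : finType) (e : rel T) : Prop :=
  [/\ simple_graph e, connected_graph e & acyclic_graph e].

Definition tree_class (d : nat) (T : finType) (e : rel T) : Prop :=
  tree e /\ forall x : T, ~~ leaf e x -> d <= degree e x.

Definition spread (T : finType) (e : rel T) (B : {set T}) : {set T} :=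
  B :|: [set y | [exists x in B, e x y]].

(* [burning_process e B s]: from the set [B] of burning vertices, the process
   runs for exactly [size s] further rounds, [s] listing the chosen vertices in
   order, and then ends. The chosen vertex must be unburned after the fire has
   spread, unless no unburned vertex is left, when the choice has no effect.
   Since [spread e set0 = set0], starting from [set0] the first round only sets
   the first chosen vertex on fire. *)
Fixpoint burning_process (T : finType) (e : rel T) (B : {set T}) (s : seq T)
    : bool :=
  if s is x :: s' then
    [&& B != [set: T],
        (x \notin spread e B) || (spread e B == [set: T])
      & burning_process e (x |: spread e B) s']
  else B == [set: T].

Definition burns_in (T : finType) (e : rel T) (k : nat) : bool :=
  [exists s : k.-tuple T, burning_process e set0 s].

Lemma burning_process_ends (T : finType) (e : rel T) (B : {set T}) :
  exists s : seq T, burning_process e B s.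
Proof.
have [n] := ubnP #|~: B|; elim: n B => // n IHn B ltBn.
have [->|nB] := eqVneq B [set: T]; first by exists [::] => /=.
have [x chx nBx] : exists2 x,
    (x \notin spread e B) || (spread e B == [set: T]) & x \notin B.
  have [eST|nS] := eqVneq (spread e B) [set: T].
    have /subsetPn[x _ nBx] : ~~ ([set: T] \subset B) by rewrite subTset.
    by exists x; rewrite // orbT.
  have /subsetPn[x _ nSx] : ~~ ([set: T] \subset spread e B) by rewrite subTset.
  by exists x; rewrite ?nSx //; apply: contra nSx; rewrite inE => ->.
have [|s burn_s] := IHn (x |: spread e B).
  rewrite -ltnS (leq_trans _ ltBn) // ltnS proper_card // properE; apply/andP.
  split; first by rewrite setCS; apply/subsetP=> y yB; rewrite !inE yB orbT.
  by apply/subsetPn; exists x; rewrite !inE ?eqxx.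
by exists (x :: s); rewrite /= nB chx.
Qed.

Lemma burns_in_exists (T : finType) (e : rel T) : exists k, burns_in e k.
Proof.
have [s burn_s] := burning_process_ends e set0.
by exists (size s); apply/existsP; exists (in_tuple s).
Qed.

Definition burning_number (T : finType) (e : rel T) : nat :=
  ex_minn (burns_in_exists e).

(* The square root is taken in the field of algebraic numbers. *)
Definition ceil_sqrt (n : nat) : int := Num.ceil (sqrtC (n%:R : algC))%R.

Definition well_burnable (T : finType) (e : rel T) : Prop :=
  ((burning_number e)%:Z <= ceil_sqrt #|T|)%R.

(* Main.v *)
(** Root a spanning tree at an internal vertex. The internal vertices form a
    set [S] closed under taking parents with [2 * #|S| + 2 <= n], and it
    suffices to cover [S] by balls of radii [0, ..., s - 1] where
    [s + 1 = k >= sqrt n], the last round burning the leaves. Pruning the branch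
    at distance [r] above a deepest vertex uses a ball of radius [r] and removes
    at least [r + 1] vertices, which covers sets of size [s (s + 1) / 2]. The
    missing [(s - 1) / 2] vertices are gained as follows: with the largest
    radius [r], either the branch has at least [r + 2] vertices, a gain of one,
    or it is a path on [r + 1] vertices, for which the radius [ceil (r / 2)] is
    enough, a gain of [floor (r / 2)] at once. *)

Require Import Defs.
From HB Require Import structures.
From mathcomp Require Import all_boot all_order all_algebra all_field.
From mathcomp Require Import zify.

Set Implicit Arguments.
Unset Strict Implicit.
Unset Printing Implicit Defensive.

Import Order.TTheory GRing.Theory Num.Theory.

(** * Burning as covering by balls *)

Lemma sub_spread (T : finType) (e : rel T) (B : {set T}) : B \subset spread e B.
Proof. exact: subsetUl. Qed.

Lemma spreadS (T : finType) (e : rel T) (A B : {set T}) :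
  A \subset B -> spread e A \subset spread e B.
Proof.
move=> sAB; apply: setUSS => //; apply/subsetP=> y; rewrite !inE.
case/exists_inP=> x xA exy; apply/exists_inP; exists x => //.
exact: (subsetP sAB).
Qed.

Lemma mem_spread (T : finType) (e : rel T) (B : {set T}) (x y : T) :
  x \in B -> e x y -> y \in spread e B.
Proof. by move=> xB exy; rewrite !inE; apply/orP; right; apply/exists_inP; exists x. Qed.

Definition ball (T : finType) (e : rel T) (r : nat) (B : {set T}) : {set T} :=
  iter r (spread e) B.

Lemma ballS (T : finType) (e : rel T) (r : nat) (A B : {set T}) :
  A \subset B -> ball e r A \subset ball e r B.
Proof. by move=> sAB; elim: r => //= r IHr; apply: spreadS. Qed.

Lemma ball_leq (T : finType) (e : rel T) (r s : nat) (B : {set T}) :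
  r <= s -> ball e r B \subset ball e s B.
Proof.
move=> /subnK <-; elim: (s - r) => //= k IHk.
exact: subset_trans IHk (sub_spread _ _).
Qed.

(** The burning process freed from the conditions on the chosen vertices and on stopping. *)
Definition fire (T : finType) (e : rel T) (B : {set T}) (cs : seq T) : {set T} :=
  foldl (fun A c => c |: spread e A) B cs.

Lemma fireS (T : finType) (e : rel T) (cs : seq T) (A B : {set T}) :
  A \subset B -> fire e A cs \subset fire e B cs.
Proof.
elim: cs A B => //= c cs IHcs A B sAB.
by apply/IHcs/setUS/spreadS.
Qed.

Lemma ball_sub_fire (T : finType) (e : rel T) (B : {set T}) (cs : seq T) :
  ball e (size cs) B \subset fire e B cs.
Proof.
elim: cs B => //= c cs IHcs B.
rewrite /ball -iterS iterSr; apply: subset_trans (IHcs _).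
exact/ballS/subsetUr.
Qed.

(** Lighting the values of [g] by decreasing index leaves exactly [j] rounds after [g j], so indices
    become radii. *)
Lemma ball_sub_fire_rev (T : finType) (e : rel T) (g : nat -> T) (k j : nat) (B : {set T}) :
  j < k -> ball e j [set g j] \subset fire e B [seq g i | i <- rev (iota 0 k)].
Proof.
elim: k B => // k IHk B.
have -> : iota 0 k.+1 = rcons (iota 0 k) k by rewrite -(addn1 k) iotaD cats1.
rewrite rev_rcons ltnS leq_eqVlt => /predU1P[->|]; last exact: IHk.
have := ball_sub_fire e (g k |: spread e B) [seq g i | i <- rev (iota 0 k)].
rewrite size_map size_rev size_iota; apply: subset_trans.
by apply: ballS; rewrite sub1set setU11.
Qed.

(* A chosen vertex that already burns is traded for an unburned one, which can
   only enlarge the fire. *)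
Lemma fire_burning_process (T : finType) (e : rel T) (cs : seq T) (B : {set T}) :
  fire e B cs = [set: T] ->
  exists2 s : seq T, size s <= size cs & burning_process e B s.
Proof.
elim: cs B => [|c cs IHcs] B /=; first by move=> ->; exists [::] => /=.
have [-> _|nB burn] := eqVneq B [set: T]; first by exists [::] => /=.
have [c' chc sub] : exists2 c', (c' \notin spread e B) || (spread e B == [set: T])
    & c |: spread e B \subset c' |: spread e B.
  case: (boolP ((c \notin spread e B) || (spread e B == [set: T]))) => [chc|].
    by exists c.
  rewrite negb_or negbK => /andP[cB nS].
  have /subsetPn[y _ ynS] : ~~ ([set: T] \subset spread e B) by rewrite subTset.
  exists y; rewrite ?ynS //; apply/subsetP=> z; rewrite in_setU1.
  by case/predU1P=> [->|zB]; rewrite in_setU1 ?cB ?zB orbT.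
have [|s les bs] := IHcs (c' |: spread e B).
  by apply/eqP; rewrite -subTset -burn; apply: fireS.
by exists (c' :: s); rewrite //= nB chc.
Qed.

Lemma burning_number_leq (T : finType) (e : rel T) (g : nat -> T) (k : nat) :
  (forall x, exists2 r, r < k & x \in ball e r [set g r]) ->
  burning_number e <= k.
Proof.
move=> cov.
have [|s] := @fire_burning_process T e [seq g i | i <- rev (iota 0 k)] set0.
  apply/setP=> x; rewrite inE; have [r ltrk xr] := cov x.
  exact: (subsetP (ball_sub_fire_rev e g set0 ltrk)).
rewrite size_map size_rev size_iota => les bs.
rewrite /burning_number; case: ex_minnP => m _ minm.
apply: leq_trans les; apply: minm; apply/existsP.
by exists (in_tuple s).
Qed.

(** * Rooted spanning trees *)

Definition rooting (T : finType) (e : rel T) (rho : T) (p : T -> T)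
    (dp : T -> nat) : Prop :=
  [/\ dp rho = 0, p rho = rho & forall x, x != rho -> e x (p x) /\ dp x = (dp (p x)).+1].

(** Breadth-first search: [dp] is the distance from [rho], and the parent is any neighbour one step
    closer to it. *)
Lemma connected_rooting (T : finType) (e : rel T) (rho : T) :
  symmetric e -> (forall x, connect e rho x) ->
  exists p, exists dp, rooting e rho p dp.
Proof.
move=> syme conn.
have ex x : exists n, x \in ball e n [set rho].
  have /connectP[q] := conn x; elim/last_ind: q x => [|q y IHq] x /=.
    by move=> _ ->; exists 0; rewrite inE.
  rewrite rcons_path last_rcons => /andP[eq elq] ->.
  have [n nq] := IHq _ eq erefl; exists n.+1.
  exact: mem_spread nq elq.
pose dp x := ex_minn (ex x).
have dp_min x n : x \in ball e n [set rho] -> dp x <= n.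
  by rewrite /dp; case: ex_minnP => m _; apply.
have dp_in x : x \in ball e (dp x) [set rho] by rewrite /dp; case: ex_minnP.
have par x : x != rho -> exists y, e x y && (dp x == (dp y).+1).
  move=> nx; have := dp_in x; have := dp_min x.
  case: (dp x) => [|n] minx; first by rewrite inE (negbTE nx).
  rewrite /= {1}/spread inE => /orP[xn|]; first by have := minx _ xn; rewrite ltnn.
  rewrite inE => /exists_inP[y yn eyx]; exists y; rewrite syme eyx /= eqSS.
  rewrite eqn_leq (dp_min _ _ yn) andbT -ltnS; apply: minx.
  exact: mem_spread (dp_in y) eyx.
(* The guard makes the search fail at the root, so the default [x] makes the root its own parent and
   iterates of [p] stop there. *)
exists (fun x => odflt x [pick y | (x != rho) && (e x y && (dp x == (dp y).+1))]).
exists dp; split.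
- by apply/eqP; rewrite -leqn0; apply: dp_min; rewrite inE.
- by case: pickP => //= y; rewrite eqxx.
- move=> x nx; case: pickP => [y /and3P[_ -> /eqP] //|].
  by have [y exy] := par x nx => /(_ y); rewrite nx exy.
Qed.

Lemma iter_root (T : Type) (p : T -> T) (rho : T) (i : nat) :
  p rho = rho -> iter i p rho = rho.
Proof. by move=> prho; elim: i => //= i ->. Qed.

Lemma depth_iter (T : finType) (e : rel T) (rho : T) (p : T -> T) (dp : T -> nat)
    (i : nat) (x : T) :
  rooting e rho p dp -> dp (iter i p x) = dp x - i.
Proof.
case=> dp0 prho par; elim: i => [|i IHi]; rewrite ?subn0 //= subnS -IHi.
have [->|/par[_ ->] //] := eqVneq (iter i p x) rho.
by rewrite prho dp0.
Qed.

Lemma iter_mem_ball (T : finType) (e : rel T) (rho : T) (p : T -> T) (dp : T -> nat)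
    (i : nat) (x : T) :
  rooting e rho p dp -> iter i p x \in ball e i [set x].
Proof.
case=> dp0 prho par; elim: i => [|i IHi]; first by rewrite inE.
have [eqr|/par[ep _]] := eqVneq (iter i p x) rho; last exact: mem_spread IHi ep.
rewrite /ball /=.
by apply: (subsetP (sub_spread _ _)); rewrite eqr prho -eqr.
Qed.

Lemma mem_ball_iter (T : finType) (e : rel T) (rho : T) (p : T -> T) (dp : T -> nat)
    (i : nat) (x : T) :
  symmetric e -> rooting e rho p dp -> x \in ball e i [set iter i p x].
Proof.
move=> syme [dp0 prho par]; elim: i => [|i IHi]; first by rewrite inE.
rewrite /ball iterSr; apply: (subsetP _ _ IHi); apply: ballS; rewrite sub1set /=.
have [->|/par[ep _]] := eqVneq (iter i p x) rho.
  by apply: (subsetP (sub_spread _ _)); rewrite prho inE.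
by apply: (mem_spread (set11 _)); rewrite syme.
Qed.

Definition parent_closed (T : finType) (p : T -> T) (S : {set T}) : Prop :=
  forall x, x \in S -> p x \in S.

Definition descendants (T : finType) (p : T -> T) (v : T) : {set T} :=
  [set x | fconnect p x v].

Lemma descendantsP (T : finType) (p : T -> T) (v x : T) :
  reflect (exists i, iter i p x = v) (x \in descendants p v).
Proof.
rewrite inE; apply: (iffP idP) => [/iter_findex <-|[i <-]]; last exact: fconnect_iter.
by exists (findex p x v).
Qed.

Lemma parent_closed_iter (T : finType) (p : T -> T) (S : {set T}) (i : nat) (x : T) :
  parent_closed p S -> x \in S -> iter i p x \in S.
Proof. by move=> clS xS; elim: i => //= i; apply: clS. Qed.

Lemma parent_closedD (T : finType) (p : T -> T) (S : {set T}) (v : T) :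
  parent_closed p S -> parent_closed p (S :\: descendants p v).
Proof.
move=> clS x /setDP[xS nx]; rewrite inE clS // andbT; apply: contra nx.
case/descendantsP=> i ei; apply/descendantsP; exists i.+1.
by rewrite iterSr.
Qed.

(** * Covering parent-closed sets by balls of distinct radii *)

Definition cover (T : finType) (e : rel T) (L : seq nat) (S : {set T}) : Prop :=
  exists f : nat -> T, forall x, x \in S -> exists2 r, r \in L & x \in ball e r [set f r].

(** As [r] is a new radius, its center can be set to [c] without disturbing the other balls. *)
Lemma cover_cons (T : finType) (e : rel T) (r : nat) (L : seq nat) (c : T) (S D : {set T}) :
  r \notin L -> S :&: D \subset ball e r [set c] -> cover e L (S :\: D) ->
  cover e (r :: L) S.
Proof.
move=> rL sD [f covf]; exists (fun i => if i == r then c else f i) => x xS.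
have [xD|nxD] := boolP (x \in D).
  by exists r; rewrite ?mem_head // eqxx; apply: (subsetP sD); rewrite inE xS.
have [|i iL xi] := covf x; first by rewrite inE nxD.
exists i; rewrite ?inE ?iL ?orbT //.
by case: eqP => // eir; rewrite -eir iL in rL.
Qed.

Lemma eq_cover (T : finType) (e : rel T) (L L' : seq nat) (S : {set T}) :
  L =i L' -> cover e L S -> cover e L' S.
Proof.
move=> eqL [f cov]; exists f => x /cov[r rL xr]; exists r => //.
by rewrite -eqL.
Qed.

(* [x] is a deepest vertex of [S], and [P] the path from [x] to its ancestor at
   distance [r]. *)
Lemma deep_branch (T : finType) (e : rel T) (rho : T) (p : T -> T) (dp : T -> nat)
    (S : {set T}) (r : nat) :
  symmetric e -> rooting e rho p dp -> parent_closed p S -> rho \in S ->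
  S \subset ball e r [set rho] \/
  exists x : T, let D := descendants p (iter r p x) in
    [/\ rho \notin D, S :&: D \subset ball e r [set iter r p x] &
    exists2 P : {set T}, P \subset S :&: D & #|P| = r.+1 /\
      forall y, y \in P -> exists2 i, i <= r & y = iter i p x].
Proof.
move=> syme rt clS rhoS; have [dp0 prho par] := rt.
case: (arg_maxnP dp rhoS) => x xS maxx.
have [ler|ltr] := leqP (dp x) r; [left|right; exists x].
  apply/subsetP=> y yS; apply: (subsetP (ball_leq _ _ (leq_trans (maxx y yS) ler))).
  (* Only the root has depth 0, since every other depth is a successor. *)
  have -> : rho = iter (dp y) p y; last exact: mem_ball_iter rt.
  have := depth_iter (dp y) y rt; rewrite subnn => eq0.
  by have [//|/par[_]] := eqVneq (iter (dp y) p y) rho; rewrite eq0.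
set v := iter r p x => D.
have dv : dp v = dp x - r by rewrite /v (depth_iter _ _ rt).
split.
- apply/negP=> /descendantsP[i]; rewrite iter_root // => eqv.
  by rewrite -eqv dp0 in dv; lia.
- apply/subsetP=> y /setIP[yS /descendantsP[i eqi]].
  have := depth_iter i y rt; rewrite eqi dv => eqd.
  (* As [r < dp x], the depth of [v] is positive, so neither subtraction is truncated, and the
     maximality of [dp x] bounds [i]. *)
  have lei : i <= r by have := maxx y yS; lia.
  by apply: (subsetP (ball_leq _ _ lei)); rewrite -eqi; apply: mem_ball_iter rt.
exists [set iter (i : 'I_r.+1) p x | i in [set: 'I_r.+1]].
  apply/subsetP=> y /imsetP[i _ ->]; rewrite inE (parent_closed_iter _ clS) //=.
  apply/descendantsP; exists (r - i); rewrite -iterD subnK //.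
  by have := ltn_ord i.
split; last first.
  by move=> y /imsetP[i _ ->]; exists i => //; have := ltn_ord i.
(* The depths [dp x - i] are distinct for [i <= r < dp x]. *)
rewrite card_imset ?cardsT ?card_ord // => i j eqij; apply: val_inj => /=.
have := congr1 dp eqij; rewrite !(depth_iter _ _ rt).
by have := ltn_ord i; have := ltn_ord j; lia.
Qed.

(** The radii may be spent in any order: each one finishes the covering or removes at least [r.+1]
    vertices. The root survives every pruning, so an exhausted list contradicts [rho \in S]. *)
Lemma cover_greedy (T : finType) (e : rel T) (rho : T) (p : T -> T) (dp : T -> nat)
    (L : seq nat) (S : {set T}) :
  symmetric e -> rooting e rho p dp -> parent_closed p S -> rho \in S ->
  uniq L -> #|S| <= \sum_(r <- L) r.+1 -> cover e L S.
Proof.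
move=> syme rt; elim: L S => [|r L IHL] S clS rhoS.
  by move=> _; rewrite big_nil leqn0 cards_eq0 => /eqP S0; rewrite S0 inE in rhoS.
rewrite big_cons => /andP[rL uL] leS.
have [sS|[x [rhoD sD [P sP [cP _]]]]] := deep_branch r syme rt clS rhoS.
  exists (fun=> rho) => x xS; exists r; rewrite ?mem_head //.
  exact: (subsetP sS).
apply: (cover_cons rL sD); apply: IHL => //.
- exact: parent_closedD.
- by rewrite inE rhoD.
- by have := subset_leq_card sP; have := cardsID (descendants p (iter r p x)) S; lia.
Qed.

Lemma cover_initial_radii (T : finType) (e : rel T) (rho : T) (p : T -> T)
    (dp : T -> nat) (s : nat) (S : {set T}) :
  symmetric e -> rooting e rho p dp -> parent_closed p S -> rho \in S ->
  0 < s -> #|S| <= \sum_(0 <= r < s) r.+1 + s.-1./2 -> cover e (iota 0 s) S.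
Proof.
move=> syme rt; elim: s S => // r IHr S clS rhoS _.
have [sS _|[x [rhoD sD [P sP [cP pathP]]]]] := deep_branch r syme rt clS rhoS.
  exists (fun=> rho) => x xS; exists r; rewrite ?mem_iota ?ltnSn //.
  exact: (subsetP sS).
set D := descendants _ _ in rhoD sD sP.
have clD : parent_closed p (S :\: D) by apply: parent_closedD.
have rhoSD : rho \in S :\: D by rewrite inE rhoD.
have cSD : 0 < #|S :\: D| by apply/card_gt0P; exists rho.
have := subset_leq_card sP; have := cardsID D S; rewrite cP leq_eqVlt => cS /predU1P[cD|ltD].
  have eqSD : P = S :&: D by apply/eqP; rewrite eqEcard sP -cD cP leqnn.
  move=> leS.
  (* The branch is a path: its midpoint replaces its top as the center. *)
  pose h := uphalf r.
  have hr : h < r.+1 by rewrite /h; lia.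
  have pm : perm_eq (h :: rem h (iota 0 r.+1)) (iota 0 r.+1).
    by rewrite perm_sym perm_to_rem // mem_iota.
  apply: (eq_cover (perm_mem pm)).
  apply: (@cover_cons _ _ _ _ (iter h p x) _ D).
  - by rewrite mem_rem_uniq ?iota_uniq // inE eqxx.
  - rewrite -eqSD; apply/subsetP=> y /pathP[i lei ->].
    have [leih|lthi] := leqP i h.
      apply: (subsetP (ball_leq _ _ (leq_subr i h))).
      have -> : iter h p x = iter (h - i) p (iter i p x) by rewrite -iterD subnK.
      exact: mem_ball_iter rt.
    have leh : i - h <= h by rewrite /h; lia.
    apply: (subsetP (ball_leq _ _ leh)).
    have -> : iter i p x = iter (i - h) p (iter h p x) by rewrite -iterD subnK // ltnW.
    exact: iter_mem_ball rt.
  (* The branch has [r.+1] vertices and the radius [h] is worth only [h.+1]; the difference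
     [r - h = r./2] is exactly the surplus in the bound on [#|S|]. *)
  apply: (cover_greedy syme rt) => //; first exact/rem_uniq/iota_uniq.
  have := perm_big _ pm => /(_ _ addn 0 predT succn) /=.
  rewrite big_cons /= -[X in _ = X]/(\sum_(0 <= j < r.+1) j.+1).
  by rewrite /h => *; lia.
(* For [r = 0] the bound allows one vertex, but the branch and the root give three. Otherwise the
   additional vertex of the branch pays for the drop from [r./2] to [r.-1./2], which is at most
   one. *)
move=> leS; have [r0|r_gt0] := posnP r; first by rewrite r0 big_nat1 in leS; lia.
rewrite big_nat_recr //= in leS.
apply: (@eq_cover _ _ (r :: iota 0 r)) => [i|].
  by rewrite inE !mem_iota; lia.
apply: (cover_cons _ sD); first by rewrite mem_iota; lia.
by apply: IHr => //=; lia.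
Qed.

(** * Counting internal vertices *)

Lemma acyclic_edge_parent (T : finType) (e : rel T) (rho : T) (p : T -> T) (dp : T -> nat)
    (x y : T) :
  simple_graph e -> acyclic_graph e -> rooting e rho p dp ->
  e x y -> (x != rho) && (y == p x) || (y != rho) && (x == p y).
Proof.
move=> [syme irre] acyc rt exy; apply/negPn/negP; rewrite negb_or !negb_and !negbK.
case/andP=> nyx nxy; have [dp0 prho par] := rt.
(* If neither end is the parent of the other, then [x] and [y] remain connected
   through the root without the edge between them. *)
pose e' := [rel a b | e a b && ~~ ((a == x) && (b == y) || (a == y) && (b == x))].
have sym' : symmetric e'.
  by move=> a b; rewrite /= syme orbC ![(a == _) && _]andbC.
have step z : connect e' z (p z).
  have [->|nz] := eqVneq z rho; first by rewrite prho.
  apply: connect1; rewrite /= (proj1 (par z nz)) /= negb_or !negb_and.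
  apply/andP; split; apply/negPn/negP; rewrite negb_or !negbK => /andP[/eqP ez /eqP ep]; subst z.
    by move: nyx; rewrite (negbTE nz) ep eqxx.
  by move: nxy; rewrite (negbTE nz) ep eqxx.
have toroot z : connect e' z rho.
  have [n] := ubnP (dp z); elim: n z => // n IHn z ltz.
  have [->|nz] := eqVneq z rho; first exact: connect0.
  by apply: connect_trans (step z) (IHn _ _); have := (par z nz).2; lia.
have : connect e' x y.
  by apply: connect_trans (toroot x) _; rewrite (sym_connect_sym sym').
case/connectP=> q0 /shortenP[q eq uq _] lq.
apply: (acyc (x :: q)).
  rewrite /ucycle uq andbT /= rcons_path -lq syme exy andbT.
  by apply: sub_path eq => a b /andP[].
(* A path shorter than two edges would be a loop or the removed edge itself. *)
case: q eq lq {uq} => [|a [|b q]] //= => [_ eyx|].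
  by rewrite eyx irre in exy.
by move=> /andP[/andP[_ +] _] eya; rewrite eya !eqxx.
Qed.

(** Count the non-root vertices by their parents: each internal vertex has at least two children,
    and the root, having no parent edge, at least three. *)
Lemma internal_card (T : finType) (e : rel T) (rho : T) (p : T -> T) (dp : T -> nat) :
  tree_class 3 e -> rooting e rho p dp -> ~~ leaf e rho ->
  (#|[set x | ~~ leaf e x]|).*2.+2 <= #|T|.
Proof.
move=> [[sg _ acyc] deg] rt nlr; have [_ _ par] := rt.
(* The root is its own parent and must not count as its own child. *)
pose ch z := [set x | (x != rho) && (p x == z)].
have ch_ge z : ~~ leaf e z -> 2 + (z == rho) <= #|ch z|.
  move=> nlz; have := deg z nlz.
  have sub : [set y | e z y] \subset ch z :|: [set y | (z != rho) && (y == p z)].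
    apply/subsetP=> y; rewrite !inE => ezy.
    by have := acyclic_edge_parent sg acyc rt ezy; rewrite orbC [p y == _]eq_sym.
  have : #|[set y | (z != rho) && (y == p z)]| <= (z != rho).
    case: (z != rho); rewrite /= -?(cards1 (p z)) -?(cards0 T);
    by apply/subset_leq_card/subsetP=> y; rewrite !inE.
  have := leq_trans (subset_leq_card sub) (leq_card_setU _ _).
  by rewrite /degree; case: (z == rho) => /=; lia.
have card_ch : #|[set x | x != rho]| = \sum_z #|ch z|.
  rewrite -sum1_card (partition_big p predT) //=; apply: eq_bigr => z _.
  by rewrite -sum1_card; apply: eq_bigl => x; rewrite !inE.
have : \sum_(z | ~~ leaf e z) (2 + (z == rho)) <= \sum_z #|ch z|.
  rewrite [X in _ <= X](bigID (fun z => ~~ leaf e z)) /=.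
  by apply: leq_trans (leq_addr _ _); apply: leq_sum.
rewrite -card_ch big_split /= sum_nat_cond_const [X in _ + X](bigD1 rho) //= eqxx.
have -> : [set x | x != rho] = [set~ rho] by apply/setP=> x; rewrite !inE.
have T_gt0 : 0 < #|T| by apply/card_gt0P; exists rho.
rewrite cardsC1 -ltnS (ltn_predK T_gt0); apply: leq_trans.
by rewrite !ltnS muln2; lia.
Qed.

(** * From the covering to the burning number *)

Lemma tree_class3_burning_number (T : finType) (e : rel T) (k : nat) :
  tree_class 3 e -> #|T| <= k ^ 2 -> burning_number e <= k.
Proof.
move=> tc lek; have [[[syme irre] [T_gt0 conn] _] deg] := tc.
have [x0 _] := card_gt0P T_gt0.
have [rho nlrho] : exists rho, ~~ leaf e rho \/ forall x, leaf e x.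
  have [rho nl|alll] := pickP (fun x => ~~ leaf e x); first by exists rho; left.
  by exists x0; right=> x; apply/negPn; rewrite alll.
have [p [dp rt]] := connected_rooting syme (conn rho).
have [_ prho par] := rt.
(* Adding [rho] matters only when all vertices are leaves; it keeps [S] nonempty then. *)
pose S := rho |: [set x | ~~ leaf e x].
(* A non-root parent is adjacent to a child and to its own parent, which differ in depth, so it is
   not a leaf. *)
have pS x : p x \in S.
  rewrite !inE; have [->|nx] := eqVneq x rho; first by rewrite prho eqxx.
  have [//|npx /=] := eqVneq (p x) rho.
  have [[exp dx] [epp dpx]] := (par x nx, par _ npx).
  apply/negP=> /eqP deg1.
  have /subset_leq_card : [set x; p (p x)] \subset [set y | e (p x) y].
    by apply/subsetP=> y; rewrite !inE => /pred2P[]->; rewrite // syme.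
  rewrite -/(degree e (p x)) deg1 cards2; case: eqVneq => // eqx.
  by rewrite -eqx in dpx; lia.
have [T_gt1 leS] : 1 < #|T| /\ (#|S| <= 1 \/ #|S|.*2.+2 <= #|T|).
  case: nlrho => [nlrho|alll].
    have eqS : S = [set x | ~~ leaf e x].
      by apply/setUidPr; rewrite sub1set inE.
    have := internal_card tc rt nlrho; rewrite -eqS => leST.
    by split; [lia|right].
  split; last by left; rewrite cardsU1; have -> : [set x | ~~ leaf e x] = set0;
    [apply/setP=> x; rewrite !inE alll | rewrite cards0 addn0 leq_b1].
  have : 0 < degree e rho by rewrite (eqP (alll rho)).
  case/card_gt0P=> y; rewrite inE => ery.
  have /subset_leq_card : [set rho; y] \subset [set: T] by [].
  rewrite cards2 cardsT; case: eqVneq => // eqy.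
  by rewrite eqy irre in ery.
case: k lek => [|[|s]] lek; [lia | lia |].
have [f covf] : cover e (iota 0 s.+1) S.
  apply: (cover_initial_radii syme rt) => //; first exact: setU11.
  have sumE n : (\sum_(0 <= r < n) r.+1).*2 = n * n.+1.
    elim: n => [|n IHn]; first by rewrite big_nil.
    by rewrite big_nat_recr //= doubleD IHn; lia.
  (* Twice the available bound is [s^2 + 3s + 2 + 2 * s./2], while
     [2 * #|S| <= (s + 2)^2 - 2 = s^2 + 4s + 2] in the main case. These agree for even [s]; for odd
     [s] they differ by one, and parity closes the gap. *)
  by have := sumE s.+1; case: leS => *; lia.
(* The radius [r] that covers [p x] becomes [r.+1], the additional round reaching [x]; hence the
   shift in [f]. *)
apply: (@burning_number_leq _ _ (fun r => f r.-1)) => x.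
have [r] := covf _ (pS x); rewrite mem_iota => /andP[_ ltr] pxr.
exists r.+1; first by lia.
have [eqx|/par[exp _]] := eqVneq x rho; last by apply: mem_spread pxr _; rewrite syme.
by apply: (subsetP (sub_spread _ _)); move: pxr; rewrite eqx prho.
Qed.

(** * The algebraic square root and the conclusion *)

Lemma leq_sqr_ceil_sqrt (n : nat) : (0 <= ceil_sqrt n)%R /\ n <= `|ceil_sqrt n| ^ 2.
Proof.
pose x : algC := sqrtC n%:R.
have x_ge0 : (0 <= x)%R by rewrite sqrtC_ge0 ler0n.
have x_le : (x <= (Num.ceil x)%:~R)%R by apply: real_ceil_ge; apply: ger0_real.
have c_ge0 : (0 <= ceil_sqrt n)%R by rewrite -(ler0z algC) (le_trans x_ge0 x_le).
split=> //; rewrite -(ler_nat algC) -[X in (X <= _)%R](sqrtCK n%:R)%R natrX.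
apply: lerXn2r; rewrite ?nnegrE ?ler0n //.
by rewrite natr_absz ger0_norm.
Qed.

Lemma tree_class3_well_burnable (T : finType) (e : rel T) :
  tree_class 3 e -> well_burnable e.
Proof.
move=> tc; have [c_ge0 len] := leq_sqr_ceil_sqrt #|T|.
by rewrite /well_burnable -(gez0_abs c_ge0) lez_nat; apply: tree_class3_burning_number.
Qed.

Theorem theorem9 :
  (forall (d : nat) (T : finType) (e : rel T),
      4 <= d -> tree_class d e -> well_burnable e) /\
  (forall (T : finType) (e : rel T),
      tree_class 3 e -> 81 <= #|T| -> well_burnable e).
Proof.
split=> [d T e led [tr deg]|T e tc _]; apply: tree_class3_well_burnable => //.
by split=> // x /deg; apply: leq_trans; apply: ltnW.
Qed.
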